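(* Let $\mathcal{A}$ be either the algebra $\langle\mathbb{N};+\rangle$ or the algebra $\langle\mathbb{N};+,\times\rangle$. A function $f:\mathbb{N}\to\mathbb{N}$ is $\mathcal{A}$-stable preorder preserving if and only if it is monotone non-decreasing and $\mathcal{A}$-congruence preserving.
   Context: A binary relation $\rho$ on $\mathbb{N}$ is $\mathcal{A}$-stable if it is compatible with each operation of $\mathcal{A}$: for a binary operation $\star$ of $\mathcal{A}$, $x\rho y$ and $x'\rho y'$ imply $(x\star x')\rho(y\star y')$. A stable preorder is a reflexive transitive stable relation; a congruence is a stable equivalence relation. $f$ is stable preorder preserving (resp. congruence preserving) if for every stable preorder (resp. congruence) $\preceq$, $x\preceq y$ implies $f(x)\preceq f(y)$. *)

(* Defs.v *)
From Stdlib Require Import List Relations.Relation_Definitions.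
Import ListNotations.

(* An algebra <nat; ...> given by the list of its (binary) operations. *)
Definition nat_algebra : Type := list (nat -> nat -> nat).

Definition add_algebra : nat_algebra := [Nat.add].
Definition add_mul_algebra : nat_algebra := [Nat.add; Nat.mul].

Definition stable (A : nat_algebra) (rho : relation nat) : Prop :=
  forall op : nat -> nat -> nat, In op A ->
  forall x y x' y' : nat, rho x y -> rho x' y' -> rho (op x x') (op y y').

Definition stable_preorder (A : nat_algebra) (rho : relation nat) : Prop :=
  preorder nat rho /\ stable A rho.

Definition congruence (A : nat_algebra) (rho : relation nat) : Prop :=
  equivalence nat rho /\ stable A rho.

Definition preserves (rho : relation nat) (f : nat -> nat) : Prop :=
  forall x y : nat, rho x y -> rho (f x) (f y).

Definition stable_preorder_preserving (A : nat_algebra) (f : nat -> nat) : Prop :=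
  forall rho : relation nat, stable_preorder A rho -> preserves rho f.

Definition congruence_preserving (A : nat_algebra) (f : nat -> nat) : Prop :=
  forall rho : relation nat, congruence A rho -> preserves rho f.

Definition monotone_nondecreasing (f : nat -> nat) : Prop :=
  forall x y : nat, x <= y -> f x <= f y.

(* Main.v *)
From Stdlib Require Import Lia List Relations.Relation_Definitions.
Require Import Defs.

(** Let [x ⪯ y] and [d = |y - x|].  The congruence that identifies [u] and [v]
    when both are at least [min x y] and congruent modulo [d] relates [x] and
    [y], so either [f x = f y], or both values are at least [min x y] and differ
    by a multiple of [d].  In the second case, translating [x ⪯ y] and chaining
    steps of length [d] goes from [f x] to [f y]; monotonicity makes [f y - f x]
    have the sign of [y - x], which is the only direction available. *)

(** The two multipliers [i] and [j] express congruence modulo [d] without subtraction and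
    symmetrically in [u] and [v]. *)
Definition cong (a d : nat) : relation nat := fun u v =>
  u = v \/ (a <= u /\ a <= v /\ exists i j, u + i * d = v + j * d).

Lemma cong_equivalence (a d : nat) : equivalence nat (cong a d).
Proof.
  split.
  - now left.
  - intros u v w [-> | (Hu & Hv & i & j & E)] [<- | (Hv' & Hw & k & l & F)].
    + now left.
    + right. repeat split; eauto.
    + right. repeat split; eauto.
    + right. repeat split; trivial. exists (i + k), (l + j). lia.
  - intros u v [-> | (Hu & Hv & i & j & E)]; [now left | right].
    repeat split; trivial. now exists j, i.
Qed.

Lemma cong_add_l (a d w u v : nat) : cong a d u v -> cong a d (w + u) (w + v).
Proof.
  intros [-> | (Hu & Hv & i & j & E)]; [now left | right].
  repeat split; try lia. exists i, j. lia.
Qed.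

Lemma cong_mul_l (a d w u v : nat) : cong a d u v -> cong a d (w * u) (w * v).
Proof.
  intros [-> | (Hu & Hv & i & j & E)]; [now left |].
  (* Multiplying by 0 may fall below [a], but then both products are equal; a positive factor keeps
     them at least [a]. *)
  destruct w as [| w]; [now left | right].
  repeat split; try nia. exists (S w * i), (S w * j).
  now rewrite <- !PeanoNat.Nat.mul_assoc, <- !PeanoNat.Nat.mul_add_distr_l, E.
Qed.

Lemma cong_congruence (A : nat_algebra) (a d : nat) :
  A = add_algebra \/ A = add_mul_algebra -> congruence A (cong a d).
Proof.
  intros hA. split; [apply cong_equivalence |].
  assert (trans := equiv_trans _ _ (cong_equivalence a d)).
  assert (Hop : forall op, In op A -> op = Nat.add \/ op = Nat.mul).
  { intros op. destruct hA as [-> | ->]; simpl; intuition. }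
  intros op Hin x y x' y' Hxy Hxy'.
  (* Change one argument at a time; commutativity reduces the left argument to the right one. *)
  apply (trans _ (op x y')); destruct (Hop op Hin) as [-> | ->].
  - now apply cong_add_l.
  - now apply cong_mul_l.
  - rewrite (PeanoNat.Nat.add_comm x), (PeanoNat.Nat.add_comm y).
    now apply cong_add_l.
  - rewrite (PeanoNat.Nat.mul_comm x), (PeanoNat.Nat.mul_comm y).
    now apply cong_mul_l.
Qed.

Lemma le_stable_preorder (A : nat_algebra) :
  A = add_algebra \/ A = add_mul_algebra -> stable_preorder A le.
Proof.
  intros hA. split.
  - split; [exact PeanoNat.Nat.le_refl | exact PeanoNat.Nat.le_trans].
  - intros op Hin x y x' y' Hxy Hxy'.
    assert (Hop : op = Nat.add \/ op = Nat.mul).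
    { destruct hA as [-> | ->]; simpl in Hin; intuition. }
    destruct Hop as [-> | ->].
    + now apply PeanoNat.Nat.add_le_mono.
    + now apply PeanoNat.Nat.mul_le_mono.
Qed.

Lemma congruence_stable_preorder (A : nat_algebra) (rho : relation nat) :
  congruence A rho -> stable_preorder A rho.
Proof. intros [[Hr Ht _] Hs]. now repeat split. Qed.

Lemma congruence_preserving_shift (A : nat_algebra) (f : nat -> nat) :
  A = add_algebra \/ A = add_mul_algebra ->
  monotone_nondecreasing f -> congruence_preserving A f ->
  forall x d, f x = f (x + d) \/
    exists t m, f x = x + t /\ f (x + d) = x + t + m * d.
Proof.
  intros hA Hm Hc x d.
  assert (Hxd : cong x d x (x + d)).
  { right. repeat split; try lia. exists 1, 0. lia. }
  destruct (Hc _ (cong_congruence A x d hA) _ _ Hxd)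
    as [E | (Hx & _ & i & j & E)]; [now left | right].
  (* Both subtractions are safe: [x <= f x], and [f x <= f (x + d)] forces [j * d <= i * d]. *)
  exists (f x - x), (i - j).
  assert (Hle : f x <= f (x + d)) by (apply Hm; lia).
  split; [lia |]. rewrite PeanoNat.Nat.mul_sub_distr_r. nia.
Qed.

(** Each step of the chain is the given pair translated by [t + m * d]. Assuming only compatibility
    with translations lets the lemma apply to the converse of a stable preorder as well. *)
Lemma stable_preorder_chain (rho : relation nat) (x d t m : nat) :
  preorder nat rho ->
  (forall u v w, rho u v -> rho (u + w) (v + w)) ->
  rho x (x + d) -> rho (x + t) (x + t + m * d).
Proof.
  intros [Hr Ht] Ha H. induction m as [| m IH].
  - rewrite PeanoNat.Nat.add_0_r. apply Hr.
  - apply (Ht _ _ _ IH).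
    replace (x + t + m * d) with (x + (t + m * d)) by lia.
    replace (x + t + S m * d) with (x + d + (t + m * d)) by lia.
    now apply Ha.
Qed.

Theorem theorem3p20 (A : nat_algebra)
    (hA : A = add_algebra \/ A = add_mul_algebra) (f : nat -> nat) :
  stable_preorder_preserving A f <->
  monotone_nondecreasing f /\ congruence_preserving A f.
Proof.
  split.
  - intros H. split.
    + exact (H le (le_stable_preorder A hA)).
    + intros rho Hrho. exact (H rho (congruence_stable_preorder A rho Hrho)).
  - intros [Hm Hc] rho [[Hr Ht] Hs] x y Hxy.
    assert (Ha : forall u v w, rho u v -> rho (u + w) (v + w)).
    { intros u v w Huv. apply (Hs Nat.add); [| exact Huv | apply Hr].
      destruct hA as [-> | ->]; now left. }
    destruct (PeanoNat.Nat.le_ge_cases x y) as [Hle | Hle].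
    + replace y with (x + (y - x)) in * by lia.
      destruct (congruence_preserving_shift A f hA Hm Hc x (y - x))
        as [E | (t & m & E & F)].
      * rewrite <- E. apply Hr.
      * rewrite E, F. now apply stable_preorder_chain.
    + replace x with (y + (x - y)) in * by lia.
      destruct (congruence_preserving_shift A f hA Hm Hc y (x - y))
        as [E | (t & m & E & F)].
      * rewrite <- E. apply Hr.
      * rewrite E, F.
        (* Climbing from [f y] to [f x] in the converse relation is descending from [f x] to [f y]
           in [rho]. *)
        apply (stable_preorder_chain (fun u v => rho v u)); auto.
        split; [exact Hr |]. intros u v w Huv Hvw. exact (Ht _ _ _ Hvw Huv).
Qed.
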